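(* Let $n\in\mathbb{N}$ and let $f:\{0,1\}^n\to\{0,1\}$ be a lattice induced threshold function. Then $f$ is isotone, i.e., for all $x,y\in\{0,1\}^n$, $x\le y$ implies $f(x)\le f(y)$.
   Context: $\{0,1\}^n$ is ordered componentwise with respect to $0\le 1$. For a complete lattice $L$ with bottom element $0$, $w\in L$ and $x\in\{0,1\}$, define $w\cdot x\in L$ by $w\cdot 1=w$ and $w\cdot 0=0$ (the bottom of $L$). A function $f:\{0,1\}^n\to\{0,1\}$ is a lattice induced threshold function if there exist a complete lattice $L$ and elements $w_1,\ldots,w_n,t\in L$ such that for all $(x_1,\ldots,x_n)\in\{0,1\}^n$: $f(x_1,\ldots,x_n)=1$ if and only if $\bigvee_{i=1}^n (w_i\cdot x_i)\ge t$. *)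

(* Defs.v *)
From mathcomp Require Import all_boot all_order.
From mathcomp Require Import classical_sets.

Set Implicit Arguments.
Unset Strict Implicit.
Unset Printing Implicit Defensive.

Import Order.Theory.

Local Open Scope classical_set_scope.
Local Open Scope order_scope.

Definition complete_lattice (d : Order.disp_t) (L : tbLatticeType d) : Prop :=
  forall A : set L, supremums A !=set0 /\ infimums A !=set0.

Definition lscale (d : Order.disp_t) (L : tbLatticeType d) (w : L) (x : bool)
  : L := if x then w else \bot.

(* {0,1}^n is [n.-tupleprod bool], i.e. bool tuples under the componentwise
   (product) order, with 0 = false <= true = 1. *)
Definition lattice_induced_threshold (n : nat) (f : n.-tupleprod bool -> bool)
  : Prop :=
  exists (d : Order.disp_t) (L : tbLatticeType d),
    complete_lattice L /\
    exists (w : 'I_n -> L) (t : L),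
      forall x : n.-tupleprod bool,
        f x = true <-> t <= \join_(i < n) lscale (w i) (tnth x i).

(* Main.v *)
Require Import Defs.
From mathcomp Require Import all_boot all_order.

Import Order.Theory.

(** For fixed weights the join of the [w i] selected by [x] is isotone in [x]:
    switching a coordinate from 0 to 1 replaces the bottom element by [w i] in
    that position, and joins preserve inequalities. A threshold [t] below the
    join for [x] is then below the larger join for [y], so [f x = true] forces
    [f y = true]. *)

Lemma lscale_le (d : Order.disp_t) (L : tbLatticeType d) (w : L) (a b : bool) :
  (a <= b)%O -> (lscale w a <= lscale w b)%O.
Proof. by case: a b => [] [] //= _; exact: le0x. Qed.

Theorem proposition3p1 (n : nat) (f : n.-tupleprod bool -> bool)
    (hf : lattice_induced_threshold f) :
  forall x y : n.-tupleprod bool, (x <= y)%O -> (f x <= f y)%O.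
Proof.
move=> x y; rewrite leEtprod => /forallP le_xy.
case: hf => d [L [_ [w [t fE]]]].
have [/fE le_t|//] := boolP (f x).
suff -> : f y = true by [].
apply/fE; apply: le_trans le_t _.
apply: (big_ind2 (fun u v => u <= v)%O) => // [*|i _]; last exact: lscale_le.
exact: leU2.
Qed.
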